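(* Let $\nu:\mathcal O(X)\to\mathcal B(\mathcal H)$ be a quantum probability measure. The following statements are equivalent: (1) $\nu$ is informationally complete; (2) $\mathcal T_\nu=\mathcal B(\mathcal H)$.
   Context: $X$ is a locally compact Hausdorff space with Borel $\sigma$-algebra $\mathcal O(X)$; $\mathcal H$ is a Hilbert space. A quantum probability measure $\nu:\mathcal O(X)\to\mathcal B(\mathcal H)$ is a map with positive operator values that is countably additive on pairwise disjoint countable families, with convergence in the ultraweak topology, and satisfies $\nu(X)=I_{\mathcal H}$. The measurement space $\mathcal T_\nu$ is the ultraweak closure in $\mathcal B(\mathcal H)$ of the complex linear span of $\{\nu(E):E\in\mathcal O(X)\}$. A density operator is a positive trace class operator of trace one. $\nu$ is informationally complete if for any density operators $\rho_1,\rho_2$ on $\mathcal H$, $\mathrm{Tr}(\rho_1\nu(E))=\mathrm{Tr}(\rho_2\nu(E))$ for every $E\in\mathcal O(X)$ implies $\rho_1=\rho_2$. *)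

(* Defs.v *)
From HB Require Import structures.
From mathcomp Require Import all_boot all_order all_algebra finmap.
From mathcomp Require Import sesquilinear complex.
From mathcomp Require Import all_classical all_reals all_analysis.
From mathcomp.analysis.showcase Require Import summability.

Set Implicit Arguments.
Unset Strict Implicit.
Unset Printing Implicit Defensive.

Import Order.TTheory GRing.Theory Num.Theory.
Import numFieldNormedType.Exports.

Local Open Scope classical_set_scope.
Local Open Scope complex_scope.
Local Open Scope ring_scope.

(* The inner product is linear in its first argument and conjugate-linear in
   its second one. *)
HB.mixin Record isHilbert (R : realType) H & CompleteNormedModule R[i] H := {
  inner : {dot H for (@Num.conj R[i])} ;
  inner_norm : forall x : H, inner x x = `|x| ^+ 2
}.

#[short(type="hilbertType")]
HB.structure Definition Hilbert (R : realType) :=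
  {H of CompleteNormedModule R[i] H & isHilbert R H}.

Section bounded_operators.
Context {R : realType} (H : hilbertType R).

Definition bounded_linear : {pred H -> H} := fun f =>
  `[< linear f /\ exists M, forall x, `|f x| <= M * `|x| >].

Record bounded_operator := BoundedOperator {
  bounded_operator_fun :> H -> H ;
  bounded_operatorP : bounded_linear bounded_operator_fun }.

HB.instance Definition _ := [isSub for bounded_operator_fun].
HB.instance Definition _ := [Choice of bounded_operator by <:].

Lemma bounded_linear_submod : submod_closed bounded_linear.
Proof.
split.
  apply/asboolP; split; first by move=> a x y /=; rewrite scaler0 addr0.
  by exists 0 => x; rewrite normr0 mul0r.
move=> a f g /asboolP[fl [M fM]] /asboolP[gl [N gN]].
apply/asboolP; split.
  move=> b x y; rewrite !fctE fl gl !scalerDr !scalerA (mulrC a).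
  by rewrite addrACA.
exists (`|a| * M + N) => x; rewrite !fctE mulrDl -mulrA.
by rewrite (le_trans (ler_normD _ _))// lerD// normrZ ler_wpM2l.
Qed.

HB.instance Definition _ :=
  GRing.isSubmodClosed.Build _ _ bounded_linear bounded_linear_submod.
HB.instance Definition _ :=
  [SubChoice_isSubLmodule of bounded_operator by <:].

Lemma bounded_operator_linear (A : bounded_operator) : linear A.
Proof. by have /asboolP[] := bounded_operatorP A. Qed.

HB.instance Definition _ (A : bounded_operator) :=
  GRing.isLinear.Build R[i] H H _ A (bounded_operator_linear A).

Definition positive_operator (A : bounded_operator) :=
  forall x, 0 <= inner (A x) x.

(* [P] is the absolute value of [T]: [P] is positive and [P P = T^* T], the
   adjoint being moved to the right-hand side of the inner product. *)
Definition absolute_value (T P : bounded_operator) :=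
  positive_operator P /\ forall x y, inner (P (P x)) y = inner (T x) (T y).

Definition orthonormal_set (E : set H) :=
  forall e f, E e -> E f -> inner e f = (e == f)%:R.

Definition orthonormal_basis (E : set H) :=
  orthonormal_set E /\ forall F, E `<` F -> ~ orthonormal_set F.

Lemma ex_orthonormal_basis : exists E, orthonormal_basis E.
Proof.
apply: Zorn_bigcup => F FO Ftot e f [A FA Ae] [B FB Bf].
by have [AB|BA] := Ftot _ _ FA FB;
  [apply: (FO _ FB) => //; exact: AB | apply: (FO _ FA) => //; exact: BA].
Qed.

Definition hilbert_basis : set H := projT1 (cid ex_orthonormal_basis).

(* The sum is that of the net of its finite partial sums, the basis being
   possibly uncountable. The trace does not depend on the basis when [f] is
   trace class; it is a junk value when the sum diverges. *)
Definition trace (f : H -> H) : R[i] :=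
  summability.sum (fun e : hilbert_basis => inner (f (val e)) (val e) : R[i]^o).

Definition trace_class : set bounded_operator := [set T | exists2 P,
  absolute_value T P &
  (\esum_(e in hilbert_basis) (complex.Re (inner (P e) e))%:E < +oo)%E].

Definition density_operator (rho : bounded_operator) :=
  [/\ positive_operator rho, trace_class rho & trace rho = 1].

(* The weak-* topology on [B(H)] as the dual of the trace class operators: the
   coarsest one making every [A |-> Tr (T A)] with [T] trace class continuous. *)
Definition ultraweak := initial_topology
  (fun (A : bounded_operator) => (fun T : trace_class =>
     trace (val T \o A)) : {ptws trace_class -> R[i]^o}).

Definition operator_span (S : set bounded_operator) : set bounded_operator :=
  [set A | exists n (c : 'I_n -> R[i]) (B : 'I_n -> bounded_operator),
     (forall i, S (B i)) /\ A = \sum_(i < n) c i *: B i].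

End bounded_operators.

Arguments hilbert_basis {R} H.
Arguments trace_class {R} H.

Definition borel (X : topologicalType) : set (set X) := <<s (@open X) >>.

Section quantum_probability_measures.
Context {R : realType} {H : hilbertType R} {X : topologicalType}.
Implicit Types nu : set X -> bounded_operator H.

(* The values of [nu] outside the Borel sets are irrelevant. *)
Definition quantum_probability_measure nu :=
  [/\ forall E, borel E -> positive_operator (nu E),
      forall F : nat -> set X, (forall n, borel (F n)) -> trivIset setT F ->
        (\sum_(0 <= k < n) nu (F k) : ultraweak H) @[n --> \oo] -->
          (nu (\bigcup_n F n) : ultraweak H) &
      nu setT = id :> (H -> H)].

Definition measurement_space nu : set (bounded_operator H) :=
  closure (operator_span (nu @` @borel X) : set (ultraweak H)).

Definition informationally_complete nu :=
  forall rho1 rho2 : bounded_operator H,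
    density_operator rho1 -> density_operator rho2 ->
    (forall E, borel E -> trace (rho1 \o nu E) = trace (rho2 \o nu E)) ->
    rho1 = rho2.

End quantum_probability_measures.

(* Main.v *)
Require Import Defs.
From mathcomp Require Import all_boot all_order all_algebra finmap.
From mathcomp Require Import sesquilinear complex.
From mathcomp Require Import all_classical all_reals all_analysis.
From mathcomp Require Import ring lra.
From mathcomp.analysis.showcase Require Import summability.

(** Bounded operators and trace class operators are paired by
    [(T, A) |-> Tr (T A)], and both properties say that the effects [nu E]
    separate the points of the trace class: density of their span is the
    annihilator condition of Hahn-Banach, informational completeness is the
    same condition restricted to differences of density operators.

    Density implies completeness because [A |-> Tr (rho A)] is linear and
    ultraweakly continuous: two densities that agree on the effects agree on
    all bounded operators, in particular on rank one operators, which read off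
    the coefficients [<rho x, e>] (lemma [trace_rank1]).

    Conversely, an ultraweak neighbourhood of [A] constrains only finitely many
    numbers [Tr (T_i B)]. By linear algebra in finite dimension
    ([common_value]), the span of the effects contains some [B] with
    [Tr (T_i B) = Tr (T_i A)] for all [i], unless a combination [T] of the
    [T_i] annihilates the effects but not [A]. Such a [T] vanishes
    ([trace_eq0]). Indeed, traces of products of Hermitian operators are real,
    hence the Hermitian and skew-Hermitian parts of [T] annihilate the effects
    too. A Hermitian [S] bounded by a positive [Q] of finite trace is the
    difference of the positive operators [S + Q] and [Q]; these have the same
    pairings with the effects, in particular the same trace since [nu X] is the
    identity, so that after normalisation completeness identifies them
    ([hermitian_trace_eq0]).

    The trace class enters only through the relation [dominates Q T]: [Q] is
    positive, has finite trace and satisfies [|<T x, x>| <= <Q x, x>]. This is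
    stable under linear combinations of [T], and polarization turns it into the
    absolute convergence of the sum of the [<T A e, e>]. A trace class [T] with
    absolute value [P] factors as [T = W^* P] and is dominated by
    [P + W^* P W] ([trace_class_dominated]).

    All convergence statements come from one inequality
    ([finite_sums_le_adj]): the sum of [<Q C e, C e>] over the basis is at most
    that of [<Q D^* e, D^* e>] as soon as [|C^* v| <= |D v|] for all [v]. It
    replaces the invariance properties of the Hilbert-Schmidt norm of
    [Q^(1/2) C]. Instead of a square root of [Q], its proof uses that the form
    of [Q] coincides, on any given finite set of vectors, with a finite sum of
    [|<x, v>|^2] that it bounds everywhere ([gram_schmidt]). *)

Set Implicit Arguments.
Unset Strict Implicit.
Unset Printing Implicit Defensive.

Import Order.TTheory GRing.Theory Num.Theory.
Import numFieldNormedType.Exports.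

Local Open Scope classical_set_scope.
Local Open Scope complex_scope.
Local Open Scope ring_scope.

Local Notation Re := complex.Re.
Local Notation Im := complex.Im.

#[local] Existing Instance totally_filter.

(** * Complex scalars and the inner product *)

Definition linear_subset {K : pzRingType} {V : lmodType K} (S : set V) :=
  S 0 /\ forall a x y, S x -> S y -> S (a *: x + y).

Section scalars.
Context {R : realType}.
Implicit Types z w : R[i].

(** Inequalities are stated between real numbers, through squared moduli and
    squared norms, because the order of [R[i]] is only partial. *)
Definition sqmod z : R := Re z ^+ 2 + Im z ^+ 2.

Lemma sqmod_ge0 z : 0 <= sqmod z.
Proof. by rewrite addr_ge0// sqr_ge0. Qed.

Lemma sqmodM z w : sqmod (z * w) = sqmod z * sqmod w.
Proof. by case: z w => [a b] [c d]; rewrite /sqmod /=; ring. Qed.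

Lemma sqmodJ z : sqmod z^*%C = sqmod z.
Proof. by case: z => [a b]; rewrite /sqmod /= sqrrN. Qed.

Lemma sqmodE z : (sqmod z)%:C = `|z| ^+ 2.
Proof. exact: add_Re2_Im2. Qed.

Lemma mulCJ z : z * z^*%C = (sqmod z)%:C.
Proof. by rewrite sqmodE sqr_normc. Qed.

Lemma mulJC z : z^*%C * z = (sqmod z)%:C.
Proof. by rewrite mulrC mulCJ. Qed.

Lemma sqmod_real (r : R) : sqmod r%:C = r ^+ 2.
Proof. by rewrite /sqmod /= expr0n addr0. Qed.

Lemma sqmod_eq0 z : sqmod z = 0 -> z = 0.
Proof.
by move=> z0; apply/eqP; rewrite -normr_eq0 -sqrf_eq0 -sqmodE z0.
Qed.

Lemma sqmodD_le z w : sqmod (z + w) <= 2 * (sqmod z + sqmod w).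
Proof.
case: z w => [a b] [c d]; rewrite /sqmod /=.
by have := sqr_ge0 (a - c); have := sqr_ge0 (b - d); nra.
Qed.

Lemma ReD z w : Re (z + w) = Re z + Re w.
Proof. by case: z w => [a b] [c d]. Qed.

Lemma ReN z : Re (- z) = - Re z.
Proof. by case: z. Qed.

Lemma ReJ z : Re z^*%C = Re z.
Proof. by case: z. Qed.

Lemma Re_realM (r : R) z : Re (r%:C * z) = r * Re z.
Proof. by case: z => [a b] /=; ring. Qed.

Lemma conj_realM (r : R) z : (r%:C * z)^*%C = r%:C * z^*%C.
Proof.
case: z => [a b]; apply/eqP; rewrite eq_complex /=.
by apply/andP; split; apply/eqP; ring.
Qed.

Lemma real_sum I (r : seq I) (P : pred I) (f : I -> R) :
  (\sum_(i <- r | P i) f i)%:C = \sum_(i <- r | P i) (f i)%:C :> R[i].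
Proof. exact: (rmorph_sum (real_complex R)). Qed.

Lemma ge0_Re z : 0 <= z -> z = (Re z)%:C.
Proof. by move=> z0; rewrite RRe_real// ger0_real. Qed.

Lemma ge0ReIm z : 0 <= Re z -> Im z = 0 -> 0 <= z.
Proof. by move=> a b; rewrite lecE /= b eqxx. Qed.

Lemma Re_ge0 z : 0 <= z -> 0 <= Re z.
Proof. by rewrite lecE => /andP[]. Qed.

Lemma real_complex_conj (r : R) : (r%:C)^*%C = r%:C.
Proof. exact: conjc_real. Qed.

Lemma le0_eps (a C : R) :
  0 <= C -> (forall e, 0 < e -> a <= C * e) -> a <= 0.
Proof.
move=> C0 h; rewrite leNgt; apply/negP => a0.
have C1 : 0 < C + 1 by lra.
have := h (a / (C + 1)) (divr_gt0 a0 C1).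
have : a / (C + 1) * (C + 1) = a by rewrite divfK// gt_eqF.
by have := divr_gt0 a0 C1; move: (a / _) => t; nra.
Qed.

End scalars.

Section positive_forms.
Context {R : realType} {V : lmodType R[i]} (b : V -> V -> R[i]).
Hypothesis bl : forall a x y z, b (a *: x + y) z = a * b x z + b y z.
Hypothesis bC : forall x y, b y x = (b x y)^*%C.
Hypothesis b_ge0 : forall x, 0 <= Re (b x x).

Lemma form_subZ x y (c : R[i]) :
  Re (b (x - c *: y) (x - c *: y)) =
  Re (b x x) - 2 * Re (c^*%C * b x y) + sqmod c * Re (b y y).
Proof.
have bl' z : b (x - c *: y) z = b x z - c * b y z.
  by rewrite addrC -scaleNr bl mulNr addrC.
rewrite bl' (bC _ x) (bC _ y) !bl' (bC x y).
case: {bl'}c => c d; case: (b x y) => p q.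
by case: (b x x) => ? ?; case: (b y y) => ? ?; rewrite /sqmod /=; ring.
Qed.

(** Stated for semi-definite forms, to be applied both to the inner product
    and to the forms of positive operators. *)
Lemma form_CauchySchwarz x y : sqmod (b x y) <= Re (b x x) * Re (b y y).
Proof.
have key t : 0 <= Re (b x x) - 2 * (t * sqmod (b x y)) +
    t ^+ 2 * sqmod (b x y) * Re (b y y).
  have := b_ge0 (x - (t%:C * b x y) *: y).
  by rewrite form_subZ sqmodM sqmod_real conj_realM -mulrA Re_realM mulJC.
have [y0|y0] := eqVneq (Re (b y y)) 0.
  have s0 := sqmod_ge0 (b x y); rewrite y0 mulr0.
  rewrite leNgt; apply/negP => sp.
  have := key ((Re (b x x) + 1) / sqmod (b x y)).
  by rewrite y0 divfK ?gt_eqF//; have := b_ge0 x; nra.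
have yp : 0 < Re (b y y) by rewrite lt0r y0 b_ge0.
have := key ((Re (b y y))^-1).
have -> : (Re (b y y))^-1 ^+ 2 * sqmod (b x y) * Re (b y y) =
  (Re (b y y))^-1 * sqmod (b x y) by field.
rewrite -ler_pdivrMr// [_ / Re _]mulrC.
by move: (_ * sqmod _) => s; lra.
Qed.

End positive_forms.

Section inner_product.
Context {R : realType} {H : hilbertType R}.
Implicit Types x y z : H.

Lemma innerC x y : inner y x = (inner x y)^*%C.
Proof. by rewrite hermC /= expr0 mul1r. Qed.

Lemma innerDl x y z : inner (x + y) z = inner x z + inner y z.
Proof. by rewrite linearDl. Qed.

Lemma innerZl a x y : inner (a *: x) y = a * inner x y.
Proof. by rewrite linearZl_LR. Qed.

Lemma innerBl x y z : inner (x - y) z = inner x z - inner y z.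
Proof. by rewrite linearBl. Qed.

Lemma innerDr x y z : inner x (y + z) = inner x y + inner x z.
Proof. by rewrite linearDr. Qed.

Lemma innerZr a x y : inner x (a *: y) = a^*%C * inner x y.
Proof. by rewrite linearZr_LR. Qed.

Lemma innerBr x y z : inner x (y - z) = inner x y - inner x z.
Proof. by rewrite linearBr. Qed.

Lemma inner0l x : inner 0 x = 0. Proof. by rewrite linear0l. Qed.

Lemma inner0r x : inner x 0 = 0. Proof. by rewrite linear0r. Qed.

Lemma inner_suml I (r : seq I) (P : pred I) (f : I -> H) x :
  inner (\sum_(i <- r | P i) f i) x = \sum_(i <- r | P i) inner (f i) x.
Proof. by rewrite linear_sumlz. Qed.

Lemma inner_sumr I (r : seq I) (P : pred I) (f : I -> H) x :
  inner x (\sum_(i <- r | P i) f i) = \sum_(i <- r | P i) inner x (f i).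
Proof. by rewrite linear_sumr. Qed.

Definition sqnorm x : R := Re (inner x x).

Lemma inner_xx x : inner x x = (sqnorm x)%:C.
Proof. by rewrite /sqnorm inner_norm RRe_real// rpredX// normr_real. Qed.

Lemma sqnorm_ge0 x : 0 <= sqnorm x.
Proof. by rewrite -ler0c -inner_xx inner_norm exprn_ge0. Qed.

Lemma sqnorm_norm x : (sqnorm x)%:C = `|x| ^+ 2.
Proof. by rewrite -inner_xx inner_norm. Qed.

Lemma sqnorm_eq0 x : sqnorm x = 0 -> x = 0.
Proof.
by move=> x0; apply/eqP; rewrite -normr_eq0 -sqrf_eq0 -sqnorm_norm x0.
Qed.

Lemma sqnorm0 : sqnorm 0 = 0. Proof. by rewrite /sqnorm inner0l. Qed.

Lemma sqnormN x : sqnorm (- x) = sqnorm x.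
Proof. by rewrite /sqnorm linearNl linearNr opprK. Qed.

Lemma sqnormBC x y : sqnorm (x - y) = sqnorm (y - x).
Proof. by rewrite -sqnormN opprB. Qed.

Lemma sqnormZ a x : sqnorm (a *: x) = sqmod a * sqnorm x.
Proof. by rewrite /sqnorm innerZl innerZr mulrA mulCJ Re_realM. Qed.

Lemma sqnorm_subZ x y (c : R[i]) :
  sqnorm (x - c *: y) = sqnorm x - 2 * Re (c^*%C * inner x y) + sqmod c * sqnorm y.
Proof.
by apply: form_subZ => *; rewrite ?innerDl ?innerZl// innerC.
Qed.

Lemma inner_CauchySchwarz x y : sqmod (inner x y) <= sqnorm x * sqnorm y.
Proof.
apply: (@form_CauchySchwarz _ _ (fun x y => inner x y)) => *.
- by rewrite ?innerDl ?innerZl.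
- by rewrite innerC.
- exact: sqnorm_ge0.
Qed.

Lemma sqnormD x y : sqnorm (x + y) = sqnorm x + sqnorm y + 2 * Re (inner x y).
Proof.
by rewrite /sqnorm innerDl !innerDr !ReD (innerC x y) ReJ; ring.
Qed.

Lemma sqnormB x y : sqnorm (x - y) = sqnorm x + sqnorm y - 2 * Re (inner x y).
Proof. by rewrite sqnormD sqnormN linearNr ReN; ring. Qed.

Lemma inner_eq0C x y : inner x y = 0 -> inner y x = 0.
Proof. by move=> xy; rewrite innerC xy conjc0. Qed.

Lemma norm_lt_sqnorm x (r : R) : 0 < r -> (`|x| < r%:C) = (sqnorm x < r ^+ 2).
Proof.
move=> r0; rewrite -(@ltr_pXn2r _ 2)// ?nnegrE ?normr_ge0 ?ler0c ?ltW//.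
by rewrite -sqnorm_norm -rmorphXn /= ltcR.
Qed.

Lemma sqnorm_complete (u : nat -> H) :
  (forall e : R, 0 < e -> exists N, forall n m, (N <= n)%N -> (N <= m)%N ->
     sqnorm (u n - u m) < e) ->
  exists w, forall e : R, 0 < e -> exists N, forall n, (N <= n)%N ->
     sqnorm (w - u n) < e.
Proof.
move=> uc; have /cauchy_cvgP/cvg_ex[/= w uw] : cauchy (u @ \oo).
  apply: cauchy_exP => e e0.
  have er : e = (Re e)%:C by rewrite -ge0_Re// ltW.
  have r0 : 0 < Re e by rewrite -ltcR -er.
  have [N hN] := uc (Re e ^+ 2) (exprn_gt0 _ r0).
  exists (u N), N => // n /= Nn.
  by rewrite -ball_normE /= er norm_lt_sqnorm// hN.
exists w => e e0.
have s0 : 0 < Num.sqrt e by rewrite sqrtr_gt0.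
move/cvgrPdist_lt : uw => /(_ (Num.sqrt e)%:C).
rewrite ltcR => /(_ s0)[N _ hN]; exists N => n Nn.
by have := hN n Nn; rewrite /= norm_lt_sqnorm// sqr_sqrtr// ltW.
Qed.

(** A sequence of [S] minimising the distance to [v] is a Cauchy sequence by
    the parallelogram law, and its limit is the orthogonal projection of [v]
    on the closure of [S]. *)
Lemma projection (S : set H) v : linear_subset S ->
  exists w, (forall e : R, 0 < e -> exists2 s, S s & sqnorm (w - s) < e) /\
            forall s, S s -> inner (v - w) s = 0.
Proof.
move=> [S0 SD].
pose E := [set sqnorm (v - s) | s in S].
have hE : has_inf E.
  split; first by exists (sqnorm (v - 0)), 0.
  by exists 0 => _ [s _ <-]; exact: sqnorm_ge0.
have infE s : S s -> inf E <= sqnorm (v - s).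
  by move=> Ss; apply: ge_inf; [case: hE | exists s].
(* The parallelogram law applies since the midpoint is in [S] too. *)
have close s t (d : R) : S s -> S t -> sqnorm (v - s) < inf E + d ->
    sqnorm (v - t) < inf E + d -> sqnorm (s - t) < 4 * d.
  move=> Ss St hs ht.
  have Sm : S (2^-1 *: s + 2^-1 *: t).
    by apply: (SD) => //; rewrite -[_ *: t]addr0; exact: SD.
  have := infE _ Sm.
  have -> : v - (2^-1 *: s + 2^-1 *: t) = (2^-1 : R)%:C *: ((v - s) + (v - t)).
    have {1}-> : v = (2^-1 : R)%:C *: (v + v).
      rewrite fmorphV rmorph_nat -mulr2n -[v *+ 2]scaler_nat scalerA.
      by rewrite mulVf ?scale1r// pnatr_eq0.
    by rewrite fmorphV rmorph_nat -scalerDr -scalerBr opprD addrACA.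
  have -> : s - t = (v - t) - (v - s).
    by rewrite opprB [RHS]addrC addrA subrK.
  rewrite sqnormB sqnormZ sqmod_real sqnormD (innerC (v - s)) ReJ.
  by move: hs ht; lra.
(* Otherwise a step along [t] would bring [s] nearer to [v] than the infimum
   allows; the distance after the step [(r * b) t] is least for
   [r = (sqnorm t)^-1]. *)
have nearly_orthogonal s t (d : R) : S s -> S t -> sqnorm (v - s) < inf E + d ->
    sqmod (inner (v - s) t) <= sqnorm t * d.
  move=> Ss St hs; set b := inner (v - s) t.
  have key (r : R) : inf E <= sqnorm (v - s) - 2 * (r * sqmod b) +
      r ^+ 2 * sqmod b * sqnorm t.
    have := infE ((r%:C * b) *: t + s) (SD _ _ _ St Ss).
    rewrite opprD (addrC (- _)) addrA sqnorm_subZ -/b conj_realM.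
    by rewrite -mulrA mulJC Re_realM /= sqmodM sqmod_real.
  have b0 := sqmod_ge0 b; have [t0|t0] := eqVneq (sqnorm t) 0.
    have := inner_CauchySchwarz (v - s) t; rewrite -/b t0; lra.
  have tp : 0 < sqnorm t by rewrite lt0r t0 sqnorm_ge0.
  have := key (sqnorm t)^-1.
  have -> : (sqnorm t)^-1 ^+ 2 * sqmod b * sqnorm t =
      (sqnorm t)^-1 * sqmod b by field.
  rewrite [sqnorm t * d]mulrC -ler_pdivrMr// [sqmod b / _]mulrC.
  by move: (_ * sqmod _) => q; lra.
have /choice[u uP] : forall n, exists s, S s /\ sqnorm (v - s) < inf E + n.+1%:R^-1.
  move=> n; have [//|_ [s Ss <-] hs] := @inf_adherent _ E n.+1%:R^-1 _ hE.
  by exists s.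
have small (e : R) : 0 < e -> exists N, forall n, (N <= n)%N ->
    sqnorm (v - u n) < inf E + e.
  move=> e0; have [N] := ltr_add_invr e0; rewrite add0r => hN.
  exists N => n Nn; apply: (lt_le_trans (proj2 (uP n))).
  rewrite lerD2l; apply: le_trans (ltW hN).
  by rewrite lef_pV2 ?posrE// ler_nat ltnS.
have [w wP] : exists w, forall e : R, 0 < e -> exists N, forall n, (N <= n)%N ->
     sqnorm (w - u n) < e.
  apply: sqnorm_complete => e e0.
  have e4 : 0 < e / 4 by rewrite divr_gt0.
  have [N hN] := small _ e4.
  exists N => n m Nn Nm; have -> : e = 4 * (e / 4) by field.
  apply: close; [exact: (uP _).1|exact: (uP _).1|exact: hN|exact: hN].
exists w; split=> [e e0|s Ss].
  by have [N hN] := wP e e0; exists (u N); [exact: (uP _).1|exact: hN].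
apply: sqmod_eq0; apply/le_anti; rewrite sqmod_ge0 andbT.
apply: (@le0_eps _ _ (4 * sqnorm s)) => [|e e0]; first by have := sqnorm_ge0 s; lra.
have [N hN] := wP e e0; have [M hM] := small e e0.
pose n := maxn N M.
have wn := hN n (leq_maxl _ _); have vn := hM n (leq_maxr _ _).
have -> : v - w = (v - u n) + (u n - w) by rewrite addrA subrK.
rewrite innerDl; apply: (le_trans (sqmodD_le _ _)).
have h1 := nearly_orthogonal _ _ _ (uP n).1 Ss vn.
have h2 := inner_CauchySchwarz (u n - w) s.
rewrite sqnormBC in h2.
by have s0 := sqnorm_ge0 s; nra.
Qed.

End inner_product.


(** * Riesz representation and adjoints *)

Section operators.
Context {R : realType} {H : hilbertType R}.
Implicit Types (x y z : H) (A B T P Q : bounded_operator H).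

Lemma operatorP A B : (forall x, A x = B x) -> A = B.
Proof. by move=> AB; apply: val_inj; apply: funext. Qed.

Lemma opD A x y : A (x + y) = A x + A y. Proof. exact: raddfD. Qed.
Lemma opZ A a x : A (a *: x) = a *: A x. Proof. exact: linearZ. Qed.
Lemma op0 A : A 0 = 0. Proof. exact: raddf0. Qed.
Lemma opB A x y : A (x - y) = A x - A y. Proof. exact: raddfB. Qed.

Lemma addopE A B x : (A + B) x = A x + B x. Proof. by []. Qed.
Lemma oppopE A x : (- A) x = - A x. Proof. by []. Qed.
Lemma scaleopE a A x : (a *: A) x = a *: A x. Proof. by []. Qed.
Lemma zeroopE x : (0 : bounded_operator H) x = 0. Proof. by []. Qed.

Lemma bounded_linearP (f : H -> H) (M : R) : linear f ->
  (forall x, sqnorm (f x) <= M * sqnorm x) -> bounded_linear f.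
Proof.
move=> fl fM; apply/asboolP; split=> //; exists (Num.sqrt `|M|)%:C => x.
rewrite -(@ler_pXn2r _ 2)// ?nnegrE ?mulr_ge0 ?ler0c ?sqrtr_ge0//.
rewrite exprMn -rmorphXn /= sqr_sqrtr// -!sqnorm_norm -rmorphM /= lecR.
by apply: (le_trans (fM x)); rewrite ler_wpM2r ?sqnorm_ge0// ler_norm.
Qed.

Lemma bounded_sqnorm A :
  exists2 M : R, 0 <= M & forall x, sqnorm (A x) <= M * sqnorm x.
Proof.
have /asboolP[_ [M AM]] := bounded_operatorP A.
exists (sqmod M) => [|x]; first exact: sqmod_ge0.
rewrite -lecR rmorphM /= !sqnorm_norm sqmodE -exprMn.
have Mx : 0 <= M * `|x| by apply: le_trans (AM x).
rewrite ler_pXn2r ?nnegrE ?mulr_ge0//; apply: (le_trans (AM x)).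
by rewrite -(ger0_norm Mx) normrM normr_id.
Qed.

Lemma idop_subproof : bounded_linear (idfun : H -> H).
Proof. by apply: (@bounded_linearP _ 1) => // x; rewrite mul1r. Qed.

Definition idop := BoundedOperator idop_subproof.

Lemma compop_subproof A B : bounded_linear (A \o B).
Proof.
have [M M0 AM] := bounded_sqnorm A; have [N N0 BN] := bounded_sqnorm B.
apply: (@bounded_linearP _ (M * N)) => [a x y|x] /=.
  by rewrite opD opZ opD opZ.
by apply: (le_trans (AM _)); rewrite -mulrA ler_wpM2l.
Qed.

Definition compop A B := BoundedOperator (compop_subproof A B).

Lemma rank1_subproof x y : bounded_linear (fun z => inner z y *: x).
Proof.
apply: (@bounded_linearP _ (sqnorm x * sqnorm y)) => [a u v|z].
  by rewrite innerDl innerZl scalerDl scalerA.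
rewrite sqnormZ mulrC -mulrA ler_wpM2l ?sqnorm_ge0// mulrC.
exact: inner_CauchySchwarz.
Qed.

Definition rank1 x y := BoundedOperator (rank1_subproof x y).

Lemma inner_inj x y : (forall z, inner z x = inner z y) -> x = y.
Proof.
move=> xy; apply/eqP; rewrite -subr_eq0; apply/eqP; apply: sqnorm_eq0.
by rewrite /sqnorm innerBr xy subrr.
Qed.

Lemma inner_closure (S : set H) w z :
  (forall e : R, 0 < e -> exists2 s, S s & sqnorm (w - s) < e) ->
  (forall s, S s -> inner s z = 0) -> inner w z = 0.
Proof.
move=> wS Sz; apply: sqmod_eq0; apply/le_anti.
rewrite sqmod_ge0 andbT; apply: (@le0_eps _ _ (sqnorm z)) => [|e e0].
  exact: sqnorm_ge0.
have [s Ss hs] := wS e e0.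
rewrite -[inner w z]subr0 -(Sz s Ss) -innerBl.
apply: (le_trans (inner_CauchySchwarz _ _)).
by rewrite mulrC ler_wpM2l ?sqnorm_ge0// ltW.
Qed.

(** A functional dominated by [P] factors through the range of [P], where it
    is represented by a vector [w] of the closure of this range; the second
    property expresses this membership by biorthogonality. As for the usual
    representation theorem, [w] is proportional to the component of [P x0]
    orthogonal to the image by [P] of the kernel of [l], for any [x0] outside
    this kernel. *)
Lemma riesz_range P (l : H -> R[i]) (C : R) : 0 <= C ->
  (forall a x y, l (a *: x + y) = a * l x + l y) ->
  (forall x, sqmod (l x) <= C * sqnorm (P x)) ->
  exists w, [/\ forall x, l x = inner (P x) w,
    forall z, (forall x, inner (P x) z = 0) -> inner w z = 0 &
    sqnorm w <= C].
Proof.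
move=> C0 ll lC.
have [l0|/existsNP[x0 lx0]] := pselect (forall x, l x = 0).
  by exists 0; split=> [x|z _|]; rewrite ?l0 ?inner0r ?inner0l ?sqnorm0.
have l00 : l 0 = 0.
  have := ll 1 0 0; rewrite scale1r addr0 mul1r -{1}[l 0]addr0.
  by move=> /addrI.
have lB x y : l (x - y) = l x - l y.
  by rewrite addrC -scaleN1r ll mulN1r addrC.
have lZ a x : l (a *: x) = a * l x by rewrite -[a *: x]addr0 ll l00 addr0.
pose S := [set P x | x in [set x | l x = 0]].
have Ssub : linear_subset S.
  split; first by exists 0; rewrite //= op0.
  move=> a _ _ [x lx <-] [y ly <-]; exists (a *: x + y); rewrite /= ?opD ?opZ//.
  by rewrite ll lx ly mulr0 addr0.
have [w [wS wperp]] := projection (P x0) Ssub.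
set u := P x0 - w in wperp.
have uw : inner u w = 0.
  by apply: inner_eq0C; apply: (inner_closure wS) => s /wperp/inner_eq0C.
(* [P (x0 - x)] splits orthogonally into [u] and [w - P x], the latter being
   as small as desired for [x] in the kernel of [l] *)
have lu : sqmod (l x0) <= C * sqnorm u.
  rewrite -subr_le0; apply: (@le0_eps _ _ C) => // e e0.
  have [_ [x lx <-] hx] := wS e e0.
  have := lC (x0 - x); rewrite lB lx subr0 opB.
  have -> : P x0 - P x = u + (w - P x) by rewrite addrA subrK.
  rewrite sqnormD innerBr uw (wperp (P x)); last by exists x.
  by rewrite subrr mulr0 addr0; nra.
have u0 : sqnorm u != 0.
  apply/eqP => u0; apply: lx0; apply: sqmod_eq0; apply/le_anti.
  by rewrite sqmod_ge0 andbT; rewrite u0 mulr0 in lu.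
have Pu : inner (P x0) u = (sqnorm u)%:C.
  by rewrite -inner_xx {2}/u innerBl (inner_eq0C uw) subr0.
pose c := l x0 / (sqnorm u)%:C.
have nz : (sqnorm u)%:C != 0 :> R[i] by rewrite (inj_eq (@complexI _) _ 0).
have lx0' : l x0 != 0 by apply/eqP.
exists (c^*%C *: u); split=> [x|z Pz|].
- have -> : P x = (l x / l x0) *: P x0 + P (x - (l x / l x0) *: x0).
    by rewrite opB opZ addrC subrK.
  rewrite innerZr conjcK innerDl innerZl Pu (innerC u) (wperp (P _)).
    by rewrite conjc0 addr0 /c mulrC -mulrA [_ * (l x0 / _)]mulrC divfK// divfK.
  exists (x - (l x / l x0) *: x0) => //=.
  by rewrite lB lZ divfK ?subrr.
- rewrite innerZl innerBl Pz sub0r; apply/eqP.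
  rewrite mulf_eq0 oppr_eq0; apply/orP; right; apply/eqP.
  by apply: (inner_closure wS) => _ [x _ <-].
- rewrite sqnormZ sqmodJ /c -fmorphV sqmodM sqmod_real /=.
  have -> : sqmod (l x0) * (sqnorm u)^-1 ^+ 2 * sqnorm u = sqmod (l x0) / sqnorm u.
    by field.
  by rewrite ler_pdivrMr// lt0r u0 sqnorm_ge0.
Qed.

(** With [P] the identity, [W] is the adjoint of [T]. With [P] the absolute
    value of [T], the equality says [T = W^* P] and [W^*] is the partial
    isometry of the polar decomposition. *)
Lemma exists_factor T P (C : R) : 0 <= C ->
  (forall x, sqnorm (T x) <= C * sqnorm (P x)) ->
  exists W : bounded_operator H, forall x y, inner (T x) y = inner (P x) (W y).
Proof.
move=> C0 TP.
have /choice[W WP] y : exists w, [/\ forall x, inner (T x) y = inner (P x) w,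
    forall z, (forall x, inner (P x) z = 0) -> inner w z = 0 &
    sqnorm w <= C * sqnorm y].
  apply: (@riesz_range P (fun x => inner (T x) y)) => [|a u v|x].
  - by rewrite mulr_ge0 ?sqnorm_ge0.
  - by rewrite opD opZ innerDl innerZl.
  - apply: (le_trans (inner_CauchySchwarz _ _)); rewrite mulrAC.
    by rewrite ler_wpM2r ?sqnorm_ge0.
(* Vectors orthogonal to all that is orthogonal to the range of [P] are
   determined by their products with this range *)
have Wuniq y w : (forall x, inner (T x) y = inner (P x) w) ->
    (forall z, (forall x, inner (P x) z = 0) -> inner w z = 0) -> w = W y.
  move=> wT wP; have [WT Wperp _] := WP y.
  apply/eqP; rewrite -subr_eq0; apply/eqP; apply: sqnorm_eq0.
  have d0 x : inner (P x) (w - W y) = 0 by rewrite innerBr -wT -WT subrr.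
  by rewrite /sqnorm innerBl wP// Wperp// subrr.
have Wlin : linear W.
  move=> a x y; have [xT xP _] := WP x; have [yT yP _] := WP y.
  apply/esym/Wuniq => [z|z Pz]; first by rewrite !innerDr !innerZr -xT -yT.
  by rewrite innerDl innerZl xP// yP// mulr0 addr0.
have Wb y : sqnorm (W y) <= C * sqnorm y by have [] := WP y.
exists (BoundedOperator (bounded_linearP Wlin Wb)) => x y /=.
by have [] := WP y.
Qed.

Lemma exists_adjoint A :
  exists B : bounded_operator H, forall x y, inner (A x) y = inner x (B y).
Proof.
have [M M0 AM] := bounded_sqnorm A.
exact: (@exists_factor A idop M).
Qed.

Definition adj A := projT1 (cid (exists_adjoint A)).

Lemma adjP A x y : inner (A x) y = inner x (adj A y).
Proof. exact: (projT2 (cid (exists_adjoint A))). Qed.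

Lemma adjP' A x y : inner (adj A x) y = inner x (A y).
Proof. by rewrite innerC -adjP -innerC. Qed.

End operators.

(** * Hilbert bases and positive operators *)

Lemma ler_sum_subseq (R : realType) (T : eqType) (s t : seq T) (f : T -> R) :
  uniq s -> uniq t -> {subset s <= t} -> (forall x, 0 <= f x) ->
  \sum_(x <- s) f x <= \sum_(x <- t) f x.
Proof.
move=> us ut st f0; have pst : perm_eq [seq x <- t | x \in s] s.
  apply: uniq_perm; rewrite ?filter_uniq// => x.
  by rewrite mem_filter; apply: andb_idr; exact: st.
rewrite [leRHS](bigID (fun x => x \in s))/= -[X in _ <= X + _]big_filter.
rewrite (perm_big _ pst) lerDl.
exact: sumr_ge0.
Qed.

Section basis.
Context {R : realType} {H : hilbertType R}.
Implicit Types (x y z : H) (s t : seq H).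
Local Notation E := (hilbert_basis H).

Definition finite_orthonormal s := uniq s /\ {in s, forall e, E e}.

Lemma hilbert_basis_orthonormal : orthonormal_set E.
Proof. by have [] := projT2 (cid (@ex_orthonormal_basis R H)). Qed.

Lemma sqnorm_basis e : E e -> sqnorm e = 1.
Proof. by move=> Ee; rewrite /sqnorm hilbert_basis_orthonormal// eqxx. Qed.

(** Otherwise [x], once normalised, could be added to the basis. *)
Lemma hilbert_basis_total x : (forall e, E e -> inner x e = 0) -> x = 0.
Proof.
move=> xE; apply: contrapT => x0.
have sx : 0 < sqnorm x.
  by rewrite lt0r sqnorm_ge0 andbT; apply/eqP => /sqnorm_eq0.
pose a : R := (Num.sqrt (sqnorm x))^-1; pose f := a%:C *: x.
have ff : inner f f = 1.
  rewrite inner_xx sqnormZ sqmod_real /a exprVn sqr_sqrtr ?ltW//.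
  by rewrite mulVf ?gt_eqF.
have fE e : E e -> inner f e = 0 by move=> Ee; rewrite innerZl xE ?mulr0.
have nEf : ~ E f.
  by move=> /fE; rewrite ff => /eqP; rewrite oner_eq0.
(* Maximality of the basis is contradicted by the adjunction of [f]. *)
have [_] := projT2 (cid (@ex_orthonormal_basis R H)).
move=> /(_ (E `|` [set f])); apply.
  split=> [e Ee|]; first by left.
  by move=> /(_ f) h; apply: nEf; apply: h; right.
move=> e g [Ee|->] [Eg|->].
- exact: hilbert_basis_orthonormal.
- rewrite (inner_eq0C (fE _ Ee)); case: eqVneq => // ef.
  by case: nEf; rewrite -ef.
- rewrite fE//; case: eqVneq => // ef.
  by case: nEf; rewrite ef.
- by rewrite ff eqxx.
Qed.

Lemma finite_orthonormal_undup s t : finite_orthonormal s ->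
  finite_orthonormal t -> finite_orthonormal (undup (s ++ t)).
Proof.
move=> [us sE] [ut tE]; split; first exact: undup_uniq.
by move=> e; rewrite mem_undup mem_cat => /orP[/sE|/tE].
Qed.

Definition partial_expansion s x := \sum_(e <- s) inner x e *: e.

Lemma inner_partial_expansion s x e : finite_orthonormal s -> e \in s ->
  inner (partial_expansion s x) e = inner x e.
Proof.
move=> [us sE] es; have Ee := sE e es.
rewrite inner_suml (bigD1_seq e)//= big_seq_cond big1 => [|f /andP[fs fe]].
  by rewrite addr0 innerZl (hilbert_basis_orthonormal Ee Ee) eqxx mulr1.
rewrite innerZl (hilbert_basis_orthonormal (sE f fs) Ee).
by rewrite (negbTE fe) mulr0.
Qed.

Lemma sqnorm_sub_partial_expansion s x : finite_orthonormal s ->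
  sqnorm (x - partial_expansion s x) = sqnorm x - \sum_(e <- s) sqmod (inner x e).
Proof.
move=> fs.
have h y : (forall e, e \in s -> inner y e = inner x e) ->
    inner y (partial_expansion s x) = (\sum_(e <- s) sqmod (inner x e))%:C.
  move=> yx; rewrite inner_sumr real_sum [LHS]big_seq [RHS]big_seq.
  by apply: eq_bigr => e es; rewrite innerZr yx// mulJC.
rewrite sqnormB h// [sqnorm (partial_expansion _ _)]/sqnorm h => [|e es].
  2: exact: inner_partial_expansion.
by rewrite /=; ring.
Qed.

Lemma bessel s x : finite_orthonormal s ->
  \sum_(e <- s) sqmod (inner x e) <= sqnorm x.
Proof.
by move=> fs; have := sqnorm_ge0 (x - partial_expansion s x);
  rewrite sqnorm_sub_partial_expansion// subr_ge0.
Qed.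

(** The vector [x] is in the closure of the linear span of the basis, since
    its difference with the projection on this closure is orthogonal to the basis;
    among the vectors supported by a finite part [s] of the basis, the partial
    expansion is the closest one to [x]. *)
Lemma parseval x (d : R) : 0 < d ->
  exists2 s, finite_orthonormal s & sqnorm x <= \sum_(e <- s) sqmod (inner x e) + d.
Proof.
move=> d0.
(* Membership in the linear span of [s], expressed by biorthogonality. *)
pose S := [set y | exists2 s, finite_orthonormal s &
  forall z, (forall e, e \in s -> inner z e = 0) -> inner y z = 0].
have [w [wS wperp]] : exists w,
    (forall e : R, 0 < e -> exists2 y, S y & sqnorm (w - y) < e) /\
    forall y, S y -> inner (x - w) y = 0.
  apply: projection; split; first by exists [::] => [|z _]; rewrite ?inner0l.
  move=> a y y' [s fs yS] [s' fs' yS'].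
  exists (undup (s ++ s')); first exact: finite_orthonormal_undup.
  move=> z zs; rewrite innerDl innerZl yS ?yS' ?mulr0 ?addr0// => e es;
    by apply: zs; rewrite mem_undup mem_cat es ?orbT.
have xw : x = w.
  apply/eqP; rewrite -subr_eq0; apply/eqP/hilbert_basis_total => e Ee.
  apply: wperp; exists [:: e].
    by split=> // f; rewrite inE => /eqP->.
  by move=> z /(_ e); rewrite inE eqxx => /(_ isT)/inner_eq0C.
have [y [s fs ys] xy] := wS d d0; exists s => //.
suff : sqnorm (x - partial_expansion s x) <= sqnorm (x - y).
  by rewrite sqnorm_sub_partial_expansion// -lerBlDl; rewrite -xw in xy; lra.
have zs e : e \in s -> inner (x - partial_expansion s x) e = 0.
  by move=> es; rewrite innerBl inner_partial_expansion// subrr.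
have -> : x - y = (x - partial_expansion s x) + (partial_expansion s x - y).
  by rewrite addrA subrK.
rewrite [leRHS]sqnormD innerBr (inner_eq0C (ys _ zs)) subr0 inner_sumr.
rewrite big_seq big1 => [|e es]; last by rewrite innerZr zs ?mulr0.
by rewrite mulr0 addr0 lerDl sqnorm_ge0.
Qed.

Lemma parseval_seq us (d : R) : 0 < d ->
  exists2 s, finite_orthonormal s &
    \sum_(u <- us) sqnorm u <= \sum_(u <- us) \sum_(e <- s) sqmod (inner u e) + d.
Proof.
elim: us d => [|u us IH] d d0.
  by exists [::]; rewrite ?big_nil ?add0r ?ltW.
have d2 : 0 < d / 2 by rewrite divr_gt0.
have [s fs us_s] := parseval u d2; have [t ft us_t] := IH _ d2.
exists (undup (s ++ t)); first exact: finite_orthonormal_undup.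
have mono v r : uniq r -> {subset r <= s ++ t} ->
    \sum_(e <- r) sqmod (inner v e) <=
    \sum_(e <- undup (s ++ t)) sqmod (inner v e).
  move=> ur rst; apply: ler_sum_subseq; rewrite ?undup_uniq//.
    by move=> e /rst; rewrite mem_undup.
  by move=> e; exact: sqmod_ge0.
rewrite !big_cons.
have := mono u s fs.1 (mem_subseq (prefix_subseq _ _)).
have : \sum_(u <- us) \sum_(e <- t) sqmod (inner u e) <=
    \sum_(u <- us) \sum_(e <- undup (s ++ t)) sqmod (inner u e).
  by apply: ler_sum => v _; apply: mono (mem_subseq (suffix_subseq _ _)); case: ft.
by lra.
Qed.

End basis.

Section positive.
Context {R : realType} {H : hilbertType R}.
Implicit Types (x y z v : H) (A B C D Q : bounded_operator H).
Local Notation E := (hilbert_basis H).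

Definition qform Q x : R := Re (inner (Q x) x).

Lemma positive_qform Q x : positive_operator Q -> inner (Q x) x = (qform Q x)%:C.
Proof. by move=> Q0; exact/ge0_Re/Q0. Qed.

Lemma qform_ge0 Q x : positive_operator Q -> 0 <= qform Q x.
Proof. by move=> Q0; exact/Re_ge0/Q0. Qed.

Lemma polarization A x y : inner (A x) y = 4^-1 * (
  inner (A (x + y)) (x + y) - inner (A (x - y)) (x - y) +
  'i * inner (A (x + 'i *: y)) (x + 'i *: y) -
  'i * inner (A (x - 'i *: y)) (x - 'i *: y)).
Proof.
rewrite !opB !opD !opZ !(innerBl, innerBr, innerZl, innerDl, innerDr, innerZr).
have -> : ('i^*)%C = - 'i :> R[i] by apply/eqP; rewrite eq_complex /= oppr0 !eqxx.
have : 'i * 'i = -1 :> R[i] by rewrite -expr2 sqr_i.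
move: 'i (inner (A x) x) (inner (A x) y) (inner (A y) x) (inner (A y) y).
move=> j a b c d jj.
transitivity (4^-1 * (2 * b + 2 * c + 2 * (j * j) * (c - b))); last first.
  by congr (_ * _); ring.
by rewrite jj; field.
Qed.

Lemma qform_real_hermitian A : (forall x, Im (inner (A x) x) = 0) ->
  forall x y, inner (A y) x = (inner (A x) y)^*%C.
Proof.
move=> A0 x y; have := A0 (x + 'i *: y); have := A0 (x + y).
rewrite !opD !opZ !(innerZl, innerDl, innerDr, innerZr).
move: (A0 x) (A0 y); case: (inner (A x) x) => a a'; case: (inner (A y) y) => d d'.
case: (inner (A x) y) => b b'; case: (inner (A y) x) => c c' /= -> -> h1 h2.
by apply/eqP; rewrite eq_complex /=; apply/andP; split; apply/eqP; lra.
Qed.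

Lemma positive_hermitian Q : positive_operator Q ->
  forall x y, inner (Q y) x = (inner (Q x) y)^*%C.
Proof.
by move=> Q0; apply: qform_real_hermitian => x; rewrite positive_qform.
Qed.

Lemma positive_CauchySchwarz Q x y : positive_operator Q ->
  sqmod (inner (Q x) y) <= qform Q x * qform Q y.
Proof.
move=> Q0; apply: (@form_CauchySchwarz _ _ (fun x y => inner (Q x) y)).
- by move=> *; rewrite opD opZ innerDl innerZl.
- exact: positive_hermitian.
- by move=> u; exact: qform_ge0.
Qed.

(** The form of [Q - |v><v|], for [v] the normalisation of [Q x0] by the
    square root of [<Q x0, x0>], remains positive by the Cauchy-Schwarz
    inequality and vanishes at [x0]: the list [vs] results from repeating this
    along [xs]. *)
Lemma gram_schmidt Q (xs : seq H) : positive_operator Q ->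
  exists vs : seq H,
    {in xs, forall x, qform Q x = \sum_(v <- vs) sqmod (inner x v)} /\
    forall x, \sum_(v <- vs) sqmod (inner x v) <= qform Q x.
Proof.
elim: xs Q => [|x0 xs IH] Q Q0.
  by exists [::]; split=> // x; rewrite big_nil qform_ge0.
have [q0|q0] := eqVneq (qform Q x0) 0.
  have [vs [vsx vsQ]] := IH Q Q0; exists vs; split=> // x.
  rewrite inE => /orP[/eqP->|/vsx//]; apply/le_anti; rewrite vsQ andbT q0.
  by apply: sumr_ge0 => v _; exact: sqmod_ge0.
have qp : 0 < qform Q x0 by rewrite lt0r q0 qform_ge0.
pose v := ((Num.sqrt (qform Q x0))^-1)%:C *: Q x0.
have xv x : sqmod (inner x v) = sqmod (inner (Q x) x0) / qform Q x0.
  rewrite innerZr sqmodM sqmodJ sqmod_real exprVn sqr_sqrtr ?ltW// mulrC.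
  by rewrite (innerC _ x) sqmodJ (positive_hermitian Q0) sqmodJ.
pose Q' := Q - rank1 v v.
have Q'E x : inner (Q' x) x = (qform Q x - sqmod (inner x v))%:C.
  rewrite addopE oppopE innerBl innerZl (innerC x v) mulCJ.
  by rewrite positive_qform// rmorphB.
have Q'0 : positive_operator Q'.
  move=> x; rewrite Q'E ler0c subr_ge0 xv ler_pdivrMr//.
  exact: positive_CauchySchwarz.
have qQ' x : qform Q x = sqmod (inner x v) + qform Q' x.
  by rewrite /(qform Q') Q'E /= addrC subrK.
have [vs [vsx vsQ]] := IH Q' Q'0; exists (v :: vs).
have vsQ' x : \sum_(v0 <- v :: vs) sqmod (inner x v0) <= qform Q x.
  by rewrite big_cons qQ' lerD2l.
split=> // x; rewrite inE => /orP[/eqP->|/vsx xE]; last by rewrite big_cons -xE.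
apply/le_anti; rewrite vsQ' andbT big_cons xv.
have -> : sqmod (inner (Q x0) x0) / qform Q x0 = qform Q x0.
  by rewrite positive_qform// sqmod_real expr2 mulfK.
by rewrite lerDl sumr_ge0// => u _; exact: sqmod_ge0.
Qed.

Definition finite_sums_le (f : H -> R) (M : R) :=
  forall s, finite_orthonormal s -> \sum_(e <- s) f e <= M.

(** For a finite part [s] of the basis, expand the form of [Q] on the images
    of [s] by [C] along finitely many vectors [v]. Exchanging the sums, the
    inequality of Bessel bounds the left-hand side by the sum of the [|C^*
    v|^2], and that of Parseval compares the sum of the [|D v|^2] with the
    right-hand side. *)
Lemma finite_sums_le_adj Q C D M : positive_operator Q ->
  (forall v, sqnorm (adj C v) <= sqnorm (D v)) ->
  finite_sums_le (fun e => qform Q (adj D e)) M ->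
  finite_sums_le (fun e => qform Q (C e)) M.
Proof.
move=> Q0 CD QDM s fs; rewrite -subr_le0.
apply: (@le0_eps _ _ 1) => // d d0; rewrite mul1r lerBlDl.
have [vs [vsC vsQ]] := gram_schmidt [seq C e | e <- s] Q0.
have [t ft vst] := parseval_seq [seq D v | v <- vs] d0.
apply: (@le_trans _ _ (\sum_(v <- vs) \sum_(e <- s) sqmod (inner (adj C v) e))).
  rewrite exchange_big /= big_seq [leRHS]big_seq; apply: ler_sum => e es.
  rewrite vsC ?map_f//; apply: ler_sum => v _.
  by rewrite adjP innerC sqmodJ.
apply: (@le_trans _ _ (\sum_(v <- vs) sqnorm (D v))).
  by apply: ler_sum => v _; exact: le_trans (bessel _ fs) (CD v).
move: vst; rewrite !big_map => /le_trans; apply; rewrite lerD2r.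
rewrite exchange_big; apply: le_trans (QDM t ft).
apply: ler_sum => e _; apply: le_trans (vsQ _).
by apply: ler_sum => v _; rewrite adjP innerC sqmodJ.
Qed.

End positive.

(** * Sums over the Hilbert basis *)

Section sums.
Context {R : realType} {H : hilbertType R}.
Implicit Types (u v : H -> R[i]) (f g : H -> R).
Local Notation E := (hilbert_basis H).

(** The net of finite partial sums whose limit defines the trace. *)
Definition has_sum u (z : R[i]) :=
  partial_sum (fun e : E => u (val e) : R[i]^o) @ totally --> (z : R[i]^o).

Lemma has_sum_sum u z : has_sum u z ->
  summability.sum (fun e : E => u (val e) : R[i]^o) = z.
Proof.
move=> uz; apply: (cvg_lim _ uz); exact: norm_hausdorff.
Qed.

Lemma has_sum_unique u z w : has_sum u z -> has_sum u w -> z = w.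
Proof. by move=> /has_sum_sum <- /has_sum_sum. Qed.

Lemma has_sum_lin a u v z w : has_sum u z -> has_sum v w ->
  has_sum (fun e => a * u e + v e) (a * z + w).
Proof.
move=> uz vw; have auv := cvgD (cvgZl_tmp (k := a) uz) vw.
rewrite /has_sum (_ : partial_sum _ =
   a \*: partial_sum (fun e : E => u (val e) : R[i]^o)
   + partial_sum (fun e : E => v (val e) : R[i]^o)).
  exact: auv.
by apply/funext => J; rewrite /partial_sum big_split -scaler_sumr.
Qed.

Lemma has_sum_ext u v z : (forall e, E e -> u e = v e) -> has_sum u z ->
  has_sum v z.
Proof.
move=> uv; rewrite /has_sum (_ : partial_sum _ =
  partial_sum (fun e : E => v (val e) : R[i]^o))//; apply/funext => J.
by apply: eq_bigr => i _; apply: uv; exact: set_valP.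
Qed.

Lemma finite_orthonormal_fset (s : seq H) : finite_orthonormal s ->
  exists J : {fset E}, forall e, (e \in [seq val i | i <- enum_fset J]) = (e \in s).
Proof.
move=> [us sE]; exists [fset x in pmap insub s]%fset => e.
apply/mapP/idP => [[i + ->]|es].
  by rewrite inE /= mem_pmap_sub.
have Ee : e \in E by rewrite inE; exact: sE.
by exists (Sub e Ee) => //; rewrite inE /= mem_pmap_sub.
Qed.

Lemma fset_finite_orthonormal (J : {fset E}) :
  finite_orthonormal [seq val i | i <- enum_fset J].
Proof.
split; first by rewrite map_inj_uniq ?fset_uniq//; exact: val_inj.
by move=> e /mapP[i _ ->]; exact: set_valP.
Qed.

Lemma partial_sumE u (J : {fset E}) :
  partial_sum (fun e : E => u (val e)) J =
  \sum_(e <- [seq val i | i <- enum_fset J]) u e.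
Proof. by rewrite big_map /partial_sum big_seq_fsetE. Qed.

Lemma has_sum_eps u z :
  (forall d : R, 0 < d -> exists2 s, finite_orthonormal s &
    forall t, finite_orthonormal t -> {subset s <= t} ->
      `|z - \sum_(e <- t) u e| < d%:C) -> has_sum u z.
Proof.
move=> uz; apply/cvgrPdist_lt => d d0.
have dE : d = (Re d)%:C by rewrite -ge0_Re// ltW.
have [|s fs hs] := uz (Re d); first by rewrite -ltcR -dE.
have [J0 J0s] := finite_orthonormal_fset fs.
exists J0 => // J /= J0J; rewrite partial_sumE dE; apply: hs.
  exact: fset_finite_orthonormal.
move=> e; rewrite -J0s => /mapP[i iJ ->]; rewrite map_f//.
exact: (fsubsetP J0J).
Qed.

(** The sum of a nonnegative family is the least bound of its finite partial
    sums. *)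
Lemma has_sum_nonneg f M : (forall e, 0 <= f e) -> finite_sums_le f M ->
  exists r : R, [/\ has_sum (fun e => (f e)%:C) r%:C, finite_sums_le f r &
    forall N, finite_sums_le f N -> r <= N].
Proof.
move=> f0 fM.
pose S := [set \sum_(e <- s) f e | s in finite_orthonormal].
have fnil : finite_orthonormal [::] by split.
have hS : has_sup S.
  split; first by exists (\sum_(e <- [::]) f e), [::].
  by exists M => _ [s fs <-]; exact: fM.
have fS : finite_sums_le f (sup S).
  by move=> s fs; apply: (sup_upper_bound hS); exists s.
exists (sup S); split=> //; last first.
  move=> N fN; apply: ge_sup; first by case: hS.
  by move=> _ [s fs <-]; exact: fN.
apply: has_sum_eps => d d0.
have [_ [s fs <-] hs] := sup_adherent d0 hS.
exists s => // t ft st; rewrite -real_sum -rmorphB /=.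
rewrite ger0_norm ?ler0c ?subr_ge0; last exact: fS.
rewrite ltcR; have := @ler_sum_subseq _ _ s t f fs.1 ft.1 st f0.
by move: hs; lra.
Qed.

Lemma has_sum_single u (e : H) : E e ->
  (forall x, E x -> x != e -> u x = 0) -> has_sum u (u e).
Proof.
move=> Ee u0; apply: has_sum_eps => d d0; exists [:: e].
  by split=> // f; rewrite inE => /eqP->.
move=> t [ut tE] et; have {}et : e \in t by apply: et; rewrite mem_head.
rewrite (bigD1_seq e)//= big_seq_cond big1 => [|f /andP[ft fe]].
  by rewrite addr0 subrr normr0 ltcR.
by rewrite u0//; exact: tE.
Qed.

Lemma finite_sums_leD f g M N : finite_sums_le f M -> finite_sums_le g N ->
  finite_sums_le (fun e => f e + g e) (M + N).
Proof.
by move=> fM gN s fs; rewrite big_split lerD// ?fM ?gN.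
Qed.

Lemma finite_sums_le_mono f g M : (forall e, f e <= g e) ->
  finite_sums_le g M -> finite_sums_le f M.
Proof.
by move=> fg gM s fs; apply: le_trans (gM s fs); exact: ler_sum.
Qed.

Lemma finite_sums_leZ f (c : R) M : 0 <= c -> finite_sums_le f M ->
  finite_sums_le (fun e => c * f e) (c * M).
Proof. by move=> c0 fM s fs; rewrite -mulr_sumr ler_wpM2l// fM. Qed.

Lemma has_sum_dominated_real f g M : (forall e, `|f e| <= g e) ->
  finite_sums_le g M -> exists r : R, has_sum (fun e => (f e)%:C) r%:C.
Proof.
move=> fg gM; have g0 e : 0 <= g e by apply: le_trans (fg e).
have h0 e : 0 <= g e + f e by have := fg e; rewrite ler_norml; lra.
have hM : finite_sums_le (fun e => g e + f e) (M + M).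
  apply: finite_sums_le_mono (finite_sums_leD gM gM) => e.
  by have := fg e; rewrite ler_norml; lra.
have [r [hr _ _]] := has_sum_nonneg g0 gM.
have [q [hq _ _]] := has_sum_nonneg h0 hM.
have hf := has_sum_lin (a := -1) hr hq.
rewrite mulN1r addrC -rmorphB in hf.
exists (q - r); apply: has_sum_ext hf => e _.
by rewrite rmorphD /= mulN1r addKr.
Qed.

Lemma has_sum_dominated u g M : (forall e, `|u e| <= (g e)%:C) ->
  finite_sums_le g M -> exists z, has_sum u z.
Proof.
move=> ug gM.
have [] := @has_sum_dominated_real (fun e => Re (u e)) g M _ gM.
  by move=> e; rewrite -lecR; apply: le_trans (ug e); exact: normc_ge_Re.
move=> a ha.
have [] := @has_sum_dominated_real (fun e => Im (u e)) g M _ gM.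
  move=> e; rewrite -lecR; apply: le_trans (ug e).
  have -> : Im (u e) = Re (- 'i * u e) by case: (u e) => p q /=; ring.
  apply: le_trans (normc_ge_Re _) _.
  have -> : `|- 'i * u e| = `|u e|.
    have i1 : `|'i%C : R[i]| = 1 by exact: normCi.
    by rewrite normrM normrN i1 mul1r.
  by [].
move=> b hb; exists ('i * b%:C + a%:C).
by apply: has_sum_ext (has_sum_lin (a := 'i) hb ha) => e _; rewrite addrC -complexE.
Qed.

End sums.

(** * Operators of finite trace *)

Section finite_trace.
Context {R : realType} {H : hilbertType R}.
Implicit Types (x y z : H) (A B C S T P Q W : bounded_operator H).
Local Notation E := (hilbert_basis H).

Lemma adj_unique A B : (forall x y, inner (A x) y = inner x (B y)) ->
  forall y, adj A y = B y.
Proof. by move=> AB y; apply: inner_inj => z; rewrite -adjP AB. Qed.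

Lemma qformZ Q a x : qform Q (a *: x) = sqmod a * qform Q x.
Proof. by rewrite /qform opZ innerZl innerZr mulrA mulCJ Re_realM. Qed.

Lemma qformD P Q x : qform (P + Q) x = qform P x + qform Q x.
Proof. by rewrite /qform addopE innerDl ReD. Qed.

Definition finite_trace Q := exists M, finite_sums_le (qform Q) M.

(** This is [finite_sums_le_adj] with [D] a multiple of the identity. *)
Lemma finite_trace_comp Q A : positive_operator Q -> finite_trace Q ->
  exists M, finite_sums_le (fun e => qform Q (A e)) M.
Proof.
move=> Q0 [M QM]; have [N N0 AN] := bounded_sqnorm (adj A).
(* The factor is chosen so that [|A^* v|^2 <= N |v|^2 = |D v|^2]. *)
pose D := (Num.sqrt N)%:C *: idop : bounded_operator H.
have DE e : adj D e = (Num.sqrt N)%:C *: e.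
  rewrite (@adj_unique D D)// => x y.
  by rewrite !scaleopE /= innerZl innerZr real_complex_conj.
exists (N * M); apply: (@finite_sums_le_adj _ _ _ _ D) => // [v|].
  by rewrite scaleopE /= sqnormZ sqmod_real sqr_sqrtr.
apply: finite_sums_le_mono (finite_sums_leZ N0 QM) => e.
by rewrite DE qformZ sqmod_real sqr_sqrtr.
Qed.

Lemma finite_trace_esum Q : positive_operator Q ->
  (\esum_(e in E) (Re (inner (Q e) e))%:E < +oo)%E <-> finite_trace Q.
Proof.
move=> Q0; have q0 e : E e -> (0 <= (Re (inner (Q e) e))%:E)%E.
  by move=> _; rewrite lee_fin; exact: qform_ge0.
split=> [Qoo|[M QM]].
  exists (fine (\esum_(e in E) (Re (inner (Q e) e))%:E)) => s [us sE].
  rewrite -lee_fin fineK; last by rewrite ge0_fin_numE// esum_ge0.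
  apply: esum_ge; exists [set` s].
    by split; [exact: finite_seq|move=> e /= /sE].
  by rewrite -fsbig_seq// sumEFin.
apply: (@le_lt_trans _ _ M%:E); last exact: ltry.
apply: ge_ereal_sup => _ [A [Af AE] <-].
rewrite fsbig_finite//= sumEFin lee_fin; apply: QM; split.
  exact: fset_uniq.
by move=> e; rewrite in_fset_set// inE => /AE.
Qed.

(** This holds for some [Q] exactly when [T] is a linear combination of
    positive operators of finite trace; it dispenses with proving that the
    absolute values of such combinations have finite trace. *)
Definition dominates Q T := [/\ positive_operator Q, finite_trace Q &
  forall x, `|inner (T x) x| <= (qform Q x)%:C].

Lemma dominates_refl Q : positive_operator Q -> finite_trace Q -> dominates Q Q.
Proof.
by move=> Q0 Qf; split=> // x; rewrite positive_qform// ger0_norm// ler0c qform_ge0.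
Qed.

Lemma dominates_lin a P Q S T : dominates P S -> dominates Q T ->
  dominates (`|a| *: P + Q) (a *: S + T).
Proof.
move=> [P0 [M PM] SP] [Q0 [N QN] TQ].
have qE x : inner ((`|a| *: P + Q) x) x = `|a| * inner (P x) x + inner (Q x) x.
  by rewrite addopE scaleopE innerDl innerZl.
have aE : `|a| = (Re `|a|)%:C by apply: ge0_Re.
have PQ0 : positive_operator (`|a| *: P + Q).
  by move=> x; rewrite qE addr_ge0// mulr_ge0.
split=> //.
  exists (Re `|a| * M + N).
  have a0 : 0 <= Re `|a| by rewrite Re_ge0.
  apply: finite_sums_le_mono (finite_sums_leD (finite_sums_leZ a0 PM) QN) => e.
  by rewrite qformD /qform scaleopE innerZl aE Re_realM.
move=> x; rewrite -positive_qform// qE addopE scaleopE innerDl innerZl.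
apply: (le_trans (ler_normD _ _)); apply: lerD; last first.
  by rewrite (positive_qform _ Q0).
by rewrite normrM ler_wpM2l// (positive_qform _ P0).
Qed.

Lemma dominates_polar Q T x y : dominates Q T ->
  `|inner (T x) y| <= (qform Q x + qform Q y)%:C.
Proof.
move=> [Q0 _ TQ]; rewrite polarization normrM.
have -> : (qform Q x + qform Q y)%:C = `|4^-1 : R[i]| *
    (qform Q (x + y) + qform Q (x - y) +
    qform Q (x + 'i *: y) + qform Q (x - 'i *: y))%:C.
  have -> : qform Q (x + y) + qform Q (x - y) +
    qform Q (x + 'i *: y) + qform Q (x - 'i *: y) = 4 * (qform Q x + qform Q y).
    rewrite /qform !opB !opD !opZ.
    rewrite !(innerBl, innerBr, innerZl, innerDl, innerDr, innerZr).
    case: (inner (Q x) x) => a a'; case: (inner (Q y) y) => d d'.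
    case: (inner (Q x) y) => b b'; case: (inner (Q y) x) => c c' /=.
    by ring.
  rewrite rmorphM /= rmorph_nat normrV ?unitfE ?pnatr_eq0// normr_nat.
  by rewrite mulKf// pnatr_eq0.
rewrite ler_wpM2l// !rmorphD /=.
have i1 (c : R[i]) : `|'i%C * c| = `|c|.
  by have i1 : `|'i%C : R[i]| = 1 by [exact: normCi]; rewrite normrM i1 mul1r.
rewrite (le_trans (ler_normB _ _))// lerD ?i1//.
rewrite (le_trans (ler_normD _ _))// lerD ?i1//.
by rewrite (le_trans (ler_normB _ _))// lerD.
Qed.

Lemma trace_has_sum Q T A : dominates Q T ->
  has_sum (fun e => inner (T (A e)) e) (trace (T \o A)).
Proof.
move=> QT; have [Q0 Qf _] := QT.
have [M QM] := finite_trace_comp A Q0 Qf; have [N QN] := Qf.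
have [|z hz] := @has_sum_dominated _ _ (fun e => inner (T (A e)) e) _ _ _
    (finite_sums_leD QM QN).
  by move=> e; exact: dominates_polar.
by rewrite /trace (has_sum_sum hz).
Qed.

Lemma trace_linl a P Q S T A : dominates P S -> dominates Q T ->
  trace ((a *: S + T) \o A) = a * trace (S \o A) + trace (T \o A).
Proof.
move=> PS QT; have := has_sum_lin (a := a) (trace_has_sum (A := A) PS)
  (trace_has_sum (A := A) QT).
apply: has_sum_unique.
apply: has_sum_ext (trace_has_sum (A := A) (dominates_lin a PS QT)).
by move=> e _; rewrite addopE scaleopE innerDl innerZl.
Qed.

Lemma trace_linr a Q T A B : dominates Q T ->
  trace (T \o (a *: A + B)) = a * trace (T \o A) + trace (T \o B).
Proof.
move=> QT; have := has_sum_lin (a := a) (trace_has_sum (A := A) QT)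
  (trace_has_sum (A := B) QT).
apply: has_sum_unique; apply: has_sum_ext (trace_has_sum QT).
by move=> e _; rewrite addopE scaleopE opD opZ innerDl innerZl.
Qed.

Lemma dominates0 : dominates (0 : bounded_operator H) 0.
Proof.
have h x : inner ((0 : bounded_operator H) x) x = 0 by rewrite zeroopE inner0l.
split=> [x||x].
- by rewrite h.
- exists 0 => s _; rewrite big1// => e _; by rewrite /qform h.
- by rewrite /qform h normr0.
Qed.

Lemma trace0 A : trace ((0 : bounded_operator H) \o A) = 0.
Proof.
have := trace_linl 1 A dominates0 dominates0.
rewrite scale1r mul1r (addr0 (0 : bounded_operator H)).
by rewrite -{1}[trace _]addr0 => /addrI.
Qed.

Lemma traceZl a Q T A : dominates Q T ->
  trace ((a *: T) \o A) = a * trace (T \o A).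
Proof.
by move=> QT; rewrite -[a *: T]addr0 (trace_linl _ _ QT dominates0) trace0 addr0.
Qed.

Lemma trace_sumr Q T n (c : 'I_n -> R[i]) (B : 'I_n -> bounded_operator H) :
  dominates Q T ->
  trace (T \o \sum_i c i *: B i) = \sum_i c i * trace (T \o B i).
Proof.
move=> QT; elim: n c B => [|n IH] c B.
  rewrite !big_ord0; have := trace_linr 1 0 0 QT.
  by rewrite scale1r mul1r addr0 -{1}[trace _]addr0 => /addrI.
by rewrite !big_ord_recl (trace_linr _ _ _ QT) IH.
Qed.

Lemma trace_suml n (c : 'I_n -> R[i]) (T : 'I_n -> bounded_operator H) :
  (forall i, exists Q, dominates Q (T i)) ->
  (exists Q, dominates Q (\sum_i c i *: T i)) /\
  forall A, trace ((\sum_i c i *: T i) \o A) = \sum_i c i * trace (T i \o A).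
Proof.
elim: n c T => [|n IH] c T QT.
  split=> [|A]; rewrite !big_ord0; first by exists 0; exact: dominates0.
  exact: trace0.
have [[Q hQ] IHt] := IH (fun i => c (lift ord0 i)) (fun i => T (lift ord0 i))
  (fun i => QT (lift ord0 i)).
have [P hP] := QT ord0.
split=> [|A]; rewrite !big_ord_recl.
  by exists (`|c ord0| *: P + Q); exact: dominates_lin.
by rewrite (trace_linl _ _ hP hQ) IHt.
Qed.

Lemma trace_rank1 T x (e : H) : E e ->
  trace (T \o rank1 x e) = inner (T x) e.
Proof.
move=> Ee; have ee := sqnorm_basis Ee.
suff h : has_sum (fun f => inner (T (rank1 x e f)) f) (inner (T x) e).
  by rewrite /trace (has_sum_sum h).
have -> : inner (T x) e = inner (T (rank1 x e e)) e.
  by rewrite /= inner_xx ee scale1r.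
apply: (has_sum_single (u := fun f => inner (T (rank1 x e f)) f)) => // f Ef fe.
by rewrite /= (hilbert_basis_orthonormal Ef Ee) (negbTE fe) scale0r op0 inner0l.
Qed.

Lemma trace_positive Q : positive_operator Q -> finite_trace Q ->
  exists2 t : R, trace Q = t%:C & finite_sums_le (qform Q) t.
Proof.
move=> Q0 Qf; have [M QM] := Qf.
have [t [ht tQ _]] := has_sum_nonneg (fun e => qform_ge0 e Q0) QM.
exists t => //; apply: has_sum_unique ht.
apply: has_sum_ext (trace_has_sum (A := idop) (dominates_refl Q0 Qf)) => e _.
by rewrite positive_qform.
Qed.

Lemma positive_trace_le0 Q : positive_operator Q -> finite_sums_le (qform Q) 0 ->
  Q = 0.
Proof.
move=> Q0 Qs; apply: operatorP => x; rewrite zeroopE.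
apply: hilbert_basis_total => e Ee; apply: sqmod_eq0; apply/le_anti.
rewrite sqmod_ge0 andbT (le_trans (positive_CauchySchwarz _ _ Q0))//.
have -> : qform Q e = 0; last by rewrite mulr0.
apply/le_anti; rewrite qform_ge0// andbT.
have := Qs [:: e]; rewrite big_seq1; apply; split=> // f.
by rewrite inE => /eqP->.
Qed.

Lemma hermitian_Im B x : (forall x y, inner (B x) y = inner x (B y)) ->
  Im (inner (B x) x) = 0.
Proof.
move=> Bh; have := Bh x x; rewrite [RHS]innerC.
by case: (inner (B x) x) => a b [] /=; lra.
Qed.

(** By polarization, the imaginary part of [<Q B e, e>] is a quarter of the
    difference between the values of the form of [Q] at [(B + i) e] and [(B -
    i) e]. The operators [B + i] and [B - i] are adjoint to each other and
    [|(B + i) v| = |(B - i) v|], so that [finite_sums_le_adj], used in both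
    directions, shows that both values have the same sum. *)
Lemma trace_hermitian_positive Q B : positive_operator Q -> finite_trace Q ->
  (forall x y, inner (B x) y = inner x (B y)) -> Im (trace (Q \o B)) = 0.
Proof.
move=> Q0 Qf Bh.
pose C1 := 'i *: idop + B : bounded_operator H.
pose C2 := (- 'i) *: idop + B : bounded_operator H.
have ic : ('i^*)%C = - 'i :> R[i] by apply/eqP; rewrite eq_complex /= oppr0 !eqxx.
have icN : ((- 'i)^*)%C = 'i :> R[i].
  by apply/eqP; rewrite eq_complex /= oppr0 opprK !eqxx.
have C1E x : C1 x = 'i *: x + B x by [].
have C2E x : C2 x = (- 'i) *: x + B x by [].
have C12 : forall y, adj C1 y = C2 y.
  apply: adj_unique => x y; rewrite C1E C2E innerDl innerDr innerZl innerZr Bh.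
  by rewrite icN.
have C21 : forall y, adj C2 y = C1 y.
  apply: adj_unique => x y; rewrite C1E C2E innerDl innerDr innerZl innerZr Bh.
  by rewrite ic.
have sq v : sqnorm (C1 v) = sqnorm (C2 v).
  rewrite C1E C2E !sqnormD !sqnormZ !innerZl -Bh.
  have := hermitian_Im v Bh; case: (inner (B v) v) => a b /= ->.
  by rewrite /sqmod /=; ring.
have q1 e : 0 <= qform Q (C1 e) by exact: qform_ge0.
have q2 e : 0 <= qform Q (C2 e) by exact: qform_ge0.
have [M1 QM1] := finite_trace_comp C1 Q0 Qf.
have [M2 QM2] := finite_trace_comp C2 Q0 Qf.
have [r1 [h1 l1 m1]] := has_sum_nonneg q1 QM1.
have [r2 [h2 l2 m2]] := has_sum_nonneg q2 QM2.
have r12 : r1 = r2.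
  apply/le_anti/andP; split; [apply: m1|apply: m2].
    apply: (@finite_sums_le_adj _ _ _ _ C1) => // [v|]; first by rewrite C12 sq.
    by apply: finite_sums_le_mono l2 => e; rewrite C12.
  apply: (@finite_sums_le_adj _ _ _ _ C2) => // [v|]; first by rewrite C21 sq.
  by apply: finite_sums_le_mono l1 => e; rewrite C21.
have QB := dominates_refl Q0 Qf.
have [N QN] := Qf; have [M QM] := finite_trace_comp B Q0 Qf.
have [|r hr] := @has_sum_dominated_real _ _ (fun e => Re (inner (Q (B e)) e)) _ _ _
    (finite_sums_leD QM QN).
  move=> e; rewrite -lecR; apply: le_trans (normc_ge_Re _) _.
  exact: (dominates_polar _ _ QB).
suff -> : trace (Q \o B) = r%:C by [].
apply: has_sum_unique (trace_has_sum (A := B) QB) _.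
have h12 := has_sum_lin (a := -1) h1 h2.
have := has_sum_lin (a := - 'i * 4^-1) h12 hr.
rewrite r12 mulN1r addNr mulr0 add0r; apply: has_sum_ext => e _.
have -> : qform Q (C1 e) = qform Q (C2 e) + 4 * Im (inner (Q (B e)) e).
  rewrite /qform C1E C2E !opD !opZ !(innerDl, innerDr, innerZl, innerZr).
  rewrite (positive_hermitian Q0 (B e) e).
  case: (inner (Q e) e) => a a'; case: (inner (Q (B e)) (B e)) => d d'.
  case: (inner (Q (B e)) e) => b b' /=.
  by ring.
rewrite rmorphD rmorphM /= rmorph_nat.
move: (qform Q _)%:C => q; rewrite [RHS]complexE complexiE.
move: (Re _)%:C (Im _)%:C => a b; by field.
Qed.

Lemma dominates_add Q S : dominates Q S ->
  (forall x, Im (inner (S x) x) = 0) ->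
  positive_operator (S + Q) /\ finite_trace (S + Q).
Proof.
move=> [Q0 [M QM] SQ] Sh.
have Sle x : `|qform S x| <= qform Q x.
  by rewrite -lecR; apply: le_trans (SQ x); exact: normc_ge_Re.
split.
  move=> x; rewrite addopE innerDl (positive_qform _ Q0); apply: ge0ReIm.
    by rewrite ReD /=; have := Sle x; rewrite ler_norml /qform; lra.
  by case: (inner (S x) x) (Sh x) => a b /= ->; rewrite addr0.
exists (M + M); apply: finite_sums_le_mono (finite_sums_leD QM QM) => e.
by rewrite qformD lerD2r; have := Sle e; rewrite ler_norml; lra.
Qed.

Lemma trace_hermitian Q S B : dominates Q S ->
  (forall x, Im (inner (S x) x) = 0) ->
  (forall x y, inner (B x) y = inner x (B y)) -> Im (trace (S \o B)) = 0.
Proof.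
move=> QS Sh Bh; have [Q0 Qf _] := QS; have [P0 Pf] := dominates_add QS Sh.
have -> : S = -1 *: Q + (S + Q) by rewrite scaleN1r addrC addrK.
rewrite (trace_linl _ _ (dominates_refl Q0 Qf) (dominates_refl P0 Pf)).
have := trace_hermitian_positive Q0 Qf Bh.
have := trace_hermitian_positive P0 Pf Bh.
case: (trace (Q \o B)) => a b; case: (trace (_ \o B)) => c d /= -> ->.
by ring.
Qed.

Lemma trace_class_positive Q : positive_operator Q -> finite_trace Q ->
  trace_class H Q.
Proof.
move=> Q0 Qf; exists Q; last exact/finite_trace_esum.
by split=> // x y; rewrite (positive_hermitian Q0 y) -innerC.
Qed.

Lemma density_normalize Q (t : R) : 0 < t -> positive_operator Q ->
  finite_trace Q -> trace Q = t%:C -> density_operator (t^-1%:C *: Q).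
Proof.
move=> t0 Q0 Qf Qt; have t'0 : 0 <= t^-1 by rewrite invr_ge0 ltW.
have tQ0 : positive_operator (t^-1%:C *: Q).
  by move=> x; rewrite scaleopE innerZl mulr_ge0 ?ler0c.
split=> //.
  apply: trace_class_positive => //; have [M QM] := Qf; exists (t^-1 * M).
  apply: finite_sums_le_mono (finite_sums_leZ t'0 QM) => e.
  by rewrite /qform scaleopE innerZl Re_realM.
have := traceZl t^-1%:C idop (dominates_refl Q0 Qf).
have -> : trace (Q \o idop) = t%:C by rewrite -Qt.
by rewrite -rmorphM /= mulVf ?gt_eqF.
Qed.

(** The absolute value [P] does not dominate [T] in general, but [<T x, x> =
    <P x, W x>] is at most [<P x, x> + <P W x, W x>]. *)
Lemma trace_class_dominated T : trace_class H T -> exists Q, dominates Q T.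
Proof.
move=> [P [P0 PT] Pf].
have /(finite_trace_esum P0) {}Pf := Pf.
have [|W WP] := @exists_factor _ _ T P 1 ler01.
  by move=> x; rewrite mul1r /sqnorm -PT; rewrite (positive_hermitian P0 x) -innerC.
pose V := compop (adj W) (compop P W).
have VE x : inner (V x) x = inner (P (W x)) (W x) by rewrite /= adjP'.
have [M PM] := Pf; have [N PN] := finite_trace_comp W P0 Pf.
exists (P + V); split.
- by move=> x; rewrite addopE innerDl VE addr_ge0.
- exists (M + N); apply: finite_sums_le_mono (finite_sums_leD PM PN) => e.
  by rewrite qformD /qform VE.
- move=> x; rewrite WP qformD [qform V x]/qform VE.
  exact: dominates_polar (dominates_refl P0 Pf).
Qed.

End finite_trace.

(** * Finitely many functionals *)

Section functionals.
Context {K : fieldType} {V : lmodType K}.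

(** The values taken on [S] by finitely many functionals form a linear
    subspace, and a point outside it is separated from it by a linear form.
    The induction eliminates one functional [f] at a time by restricting the
    others to its kernel in [S]. *)
Lemma common_value n (S : set V) (phi : 'I_n -> V -> K) (v : V) :
  linear_subset S ->
  (forall i a x y, phi i (a *: x + y) = a * phi i x + phi i y) ->
  (forall c : 'I_n -> K, (forall x, S x -> \sum_i c i * phi i x = 0) ->
     \sum_i c i * phi i v = 0) ->
  exists2 s, S s & forall i, phi i s = phi i v.
Proof.
elim: n S phi v => [|n IH] S phi v [S0 SD] phil Sv.
  by exists 0 => // -[].
pose f := phi ord0; pose psi i := phi (lift ord0 i).
have [f0|/existsNP[s1 /not_implyP[Ss1 fs1]]] :=
    pselect (forall x, S x -> f x = 0).
  have [||c cS|s Ss hs] := IH S psi v.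
  - by split.
  - by move=> i; exact: phil.
  - pose c' i := oapp c 0 (unlift ord0 i).
    have E x : \sum_i c' i * phi i x = \sum_i c i * psi i x.
      rewrite big_ord_recl /c' unlift_none /= mul0r add0r.
      by apply: eq_bigr => i _; rewrite liftK.
    by rewrite -E; apply: Sv => x Sx; rewrite E cS.
  - exists s => // i; case: (unliftP ord0 i) => [j ->|->]; first exact: hs.
    rewrite -/f f0//.
    have := Sv (fun i => (i == ord0)%:R).
    have E x : \sum_(i < n.+1) (i == ord0)%:R * phi i x = f x.
      rewrite big_ord_recl eqxx mul1r big1 ?addr0// => j _.
      by rewrite -(inj_eq val_inj) /= mul0r.
    by rewrite E => -> // x Sx; rewrite E f0.
have f1 : f s1 != 0 by apply/eqP.
have lin0 i : phi i 0 = 0.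
  have := phil i 1 0 0; rewrite scale1r mul1r addr0 -{1}[phi i 0]addr0.
  by move/addrI.
pose S' := [set x | S x /\ f x = 0].
pose b := f v / f s1.
have [||c cS|s [Ss fs] hs] := IH S' psi (- b *: s1 + v).
- split; first by split=> //; exact: lin0.
  move=> a x y [Sx fx] [Sy fy]; split; first exact: SD.
  by rewrite /f phil -/f fx fy mulr0 addr0.
- by move=> i; exact: phil.
- (* a combination vanishing on the kernel of [f] in [S] vanishes on [S] once
     corrected by a multiple of [f] *)
  pose d := (\sum_i c i * psi i s1) / f s1.
  pose c' i := oapp c (- d) (unlift ord0 i).
  have E x : \sum_i c' i * phi i x = - d * f x + \sum_i c i * psi i x.
    rewrite big_ord_recl /c' unlift_none /=; congr (_ + _).
    by apply: eq_bigr => i _; rewrite liftK.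
  have cl a x y : \sum_i c i * psi i (a *: x + y) =
      a * (\sum_i c i * psi i x) + \sum_i c i * psi i y.
    rewrite mulr_sumr -big_split; apply: eq_bigr => i _ /=.
    by rewrite /psi phil mulrDr mulrCA.
  have := Sv c'; rewrite E => cv; rewrite cl.
  have : - d * f v + \sum_i c i * psi i v = 0.
    apply: cv => x Sx; rewrite E.
    have := cS (- (f x / f s1) *: s1 + x); rewrite cl => h.
    rewrite -[RHS]h.
      by rewrite /d; move: (\sum_i _) (\sum_i _) => p q; field.
    split; first exact: SD.
    by rewrite /f phil -/f mulNr divfK// addNr.
  by rewrite /d /b; move: (\sum_i _) (\sum_i _) => p q <-; field.
- exists (b *: s1 + s); first exact: SD.
  move=> i; case: (unliftP ord0 i) => [j ->|->].
    rewrite phil -/(psi j s) hs /psi phil.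
    by rewrite addrA -mulrDl subrr mul0r add0r.
  by rewrite phil -/(f s1) -/(f s) fs addr0 /b divfK.
Qed.

End functionals.

Section span.
Context {R : realType} {H : hilbertType R}.
Implicit Types (A B : bounded_operator H).

Lemma operator_span0 (D : set (bounded_operator H)) : operator_span D 0.
Proof. by exists 0%N, (fun=> 0), (fun=> 0); split=> [[]//|]; rewrite big_ord0. Qed.

Lemma operator_span_lin (D : set (bounded_operator H)) a A B :
  operator_span D A -> operator_span D B -> operator_span D (a *: A + B).
Proof.
move=> [n [c [C [CD ->]]]] [m [d [E [ED ->]]]].
exists (n + m)%N,
  (fun i : 'I_(n + m) =>
     match fintype.split i with inl j => a * c j | inr j => d j end),
  (fun i : 'I_(n + m) => match fintype.split i with inl j => C j | inr j => E j end).
split=> [i|]; first by case: (fintype.split i).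
rewrite big_split_ord scaler_sumr; congr (_ + _); apply: eq_bigr => i _.
  by rewrite (unsplitK (inl i)) scalerA.
by rewrite (unsplitK (inr i)).
Qed.

Lemma operator_span_sub (D : set (bounded_operator H)) A : D A -> operator_span D A.
Proof.
move=> DA; exists 1%N, (fun=> 1), (fun=> A); split=> //.
by rewrite big_ord1 scale1r.
Qed.

End span.

(** * Ultraweak topology and the two implications *)

Section ultraweak.
Context {R : realType} {H : hilbertType R}.
Implicit Types (A B T : bounded_operator H).

(** Equality with the limit value, rather than convergence to it, suffices
    here because finitely many pairings of [A] can be matched exactly. *)
Lemma ultraweak_cvg (F : set_system (bounded_operator H)) A : Filter F ->
  (forall T, trace_class H T ->
     F [set B : bounded_operator H | trace (T \o B) = trace (T \o A)]) ->
  F --> (A : ultraweak H).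
Proof.
move=> FF FT; pose phi (B : bounded_operator H) : {ptws trace_class H -> R[i]^o} :=
  fun T : trace_class H => trace (val T \o B).
have phiA : phi @ F --> phi A.
  apply/cvg_sup => T U; rewrite nbhsE => -[_ [[V oV <-] VA] VU].
  apply: (@filterS _ F FF _ _ _ (FT (val T) (set_valP T))) => B BA.
  apply: VU; have {}BA : phi B T = phi A T := BA.
  by rewrite /preimage /mkset BA.
move=> U; rewrite nbhsE /= => -[_ [[V oV <-] VA] VU].
apply: (filterS VU); apply: phiA; apply: open_nbhs_nbhs; split=> //.
Qed.

Lemma ultraweak_trace_continuous T : trace_class H T ->
  continuous (fun A : ultraweak H => trace (T \o A) : R[i]^o).
Proof.
move=> Tt.
pose phi (B : bounded_operator H) : {ptws trace_class H -> R[i]^o} :=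
  fun T : trace_class H => trace (val T \o B).
have Tm : T \in trace_class H by rewrite inE.
pose i : trace_class H := Sub T Tm.
have c1 : continuous (phi : ultraweak H -> _) by exact: initial_continuous.
have c2 := @proj_continuous (trace_class H) (fun=> R[i]^o) i.
by move=> A; exact: (continuous_comp (c1 A) (c2 (phi A))).
Qed.

End ultraweak.


Section quantum_probability.
Context {R : realType} {H : hilbertType R}.
Context {X : topologicalType} (nu : set X -> bounded_operator H).
Hypothesis hnu : quantum_probability_measure nu.
Implicit Types (A B P Q S T : bounded_operator H).

Lemma nu_hermitian E : borel E -> forall x y, inner (nu E x) y = inner x (nu E y).
Proof.
have [nu0 _ _] := hnu => /nu0 nuE0 x y.
by rewrite (positive_hermitian nuE0 y) -innerC.
Qed.

(** The positive operators [S + Q] and [Q] have the same pairings with the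
    effects. Their common trace [t] is either zero, and both vanish, or
    positive, and both are multiples of density operators. *)
Lemma hermitian_trace_eq0 Q S : informationally_complete nu ->
  dominates Q S -> (forall x, Im (inner (S x) x) = 0) ->
  (forall E, borel E -> trace (S \o nu E) = 0) -> S = 0.
Proof.
move=> ic QS Sh S0; have [Q0 Qf _] := QS; have [P0 Pf] := dominates_add QS Sh.
set P := S + Q in P0 Pf.
have PQ E : borel E -> trace (P \o nu E) = trace (Q \o nu E).
  move=> bE; have := trace_linl 1 (nu E) QS (dominates_refl Q0 Qf).
  by rewrite scale1r mul1r S0// add0r.
have [_ _ nuT] := hnu.
have tPQ : trace P = trace Q.
  have bT : borel [set: X] by apply: sub_sigma_algebra; exact: openT.
  by have := PQ _ bT; rewrite nuT.
have [t Qt tQ] := trace_positive Q0 Qf.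
have [t' Pt tP] := trace_positive P0 Pf.
have tt' : t' = t by apply: complexI; rewrite -Pt -Qt.
subst t'; have SE : S = P - Q by rewrite addrK.
have [t0|t0] := leP t 0.
  have lt0 (f : H -> R) : finite_sums_le f t -> finite_sums_le f 0.
    by move=> ft s fs; apply: le_trans t0; exact: ft.
  rewrite SE (positive_trace_le0 P0 (lt0 _ tP)).
  by rewrite (positive_trace_le0 Q0 (lt0 _ tQ)) subr0.
have tn : t^-1%:C != 0 :> R[i].
  by rewrite (inj_eq (@complexI _) _ 0) invr_eq0 gt_eqF.
have : t^-1%:C *: P = t^-1%:C *: Q.
  apply: ic; [exact: density_normalize|exact: density_normalize|].
  move=> E bE; rewrite (traceZl _ _ (dominates_refl P0 Pf)).
  by rewrite (traceZl _ _ (dominates_refl Q0 Qf)) PQ.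
by move=> /(scalerI tn) PQe; rewrite SE PQe subrr.
Qed.

(** Let [s] be the trace of [T^* nu(E)]. As [T + T^*] is Hermitian, as well as
    the product of [T - T^*] by [i], and as [T nu(E)] has trace zero, both [s]
    and [- i s] are real, so that [s = 0]. *)
Lemma trace_eq0 Q T : informationally_complete nu ->
  dominates Q T -> (forall E, borel E -> trace (T \o nu E) = 0) -> T = 0.
Proof.
move=> ic QT T0.
have [Q0 Qf TQ] := QT.
have adjE x : inner (adj T x) x = (inner (T x) x)^*%C.
  by rewrite adjP' innerC.
have Qadj : dominates Q (adj T) by split=> // x; rewrite adjE normcJ.
have Q1 := dominates_lin 1 QT Qadj.
have Q2 := dominates_lin 'i (dominates_lin (-1) Qadj QT) dominates0.
set T1 := 1 *: T + adj T in Q1.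
set T2 := 'i *: (-1 *: adj T + T) + 0 in Q2.
have h1 x : Im (inner (T1 x) x) = 0.
  rewrite addopE scaleopE scale1r innerDl adjE.
  by case: (inner _ _) => a b /=; rewrite subrr.
have h2 x : Im (inner (T2 x) x) = 0.
  rewrite /T2 addr0 scaleopE addopE scaleopE innerZl innerDl innerZl adjE.
  by rewrite -complexiE; case: (inner _ _) => a b /=; ring.
have adjT0 E : borel E -> trace (adj T \o nu E) = 0.
  move=> bE; have := trace_hermitian Q1 h1 (nu_hermitian bE).
  have := trace_hermitian Q2 h2 (nu_hermitian bE).
  rewrite /T1 (trace_linl _ _ QT Qadj) /T2.
  rewrite (trace_linl _ _ (dominates_lin (-1) Qadj QT) dominates0).
  rewrite trace0 (trace_linl _ _ Qadj QT) T0// !addr0 mulr0 add0r -complexiE.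
  case: (trace _) => a b /= k2 k1.
  by apply/eqP; rewrite eq_complex /=; apply/andP; split; apply/eqP; lra.
have T10 : T1 = 0.
  apply: (hermitian_trace_eq0 ic Q1 h1) => E bE.
  by rewrite (trace_linl _ _ QT Qadj) T0// adjT0// mulr0 addr0.
have T20 : T2 = 0.
  apply: (hermitian_trace_eq0 ic Q2 h2) => E bE.
  rewrite (trace_linl _ _ (dominates_lin (-1) Qadj QT) dominates0).
  by rewrite (trace_linl _ _ Qadj QT) trace0 T0// adjT0// mulr0 !addr0 mulr0.
have TadjT : T = adj T.
  move/eqP: T20; rewrite /T2 addr0 scaler_eq0 (negbTE (neq0Ci _)) /=.
  rewrite scaleN1r addrC subr_eq0.
  by move/eqP.
move/eqP: T10; rewrite /T1 scale1r -TadjT -mulr2n -scaler_nat scaler_eq0.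
by rewrite pnatr_eq0 => /eqP.
Qed.

Lemma complete_dense : informationally_complete nu ->
  measurement_space nu = [set: bounded_operator H].
Proof.
move=> ic; apply/seteqP; split=> // A _.
pose Sp := operator_span (nu @` @borel X).
pose V (J : seq (trace_class H)) := [set B | Sp B /\
  forall T : trace_class H, T \in J ->
    trace (val T \o B) = trace (val T \o A)].
have dom (T : trace_class H) : exists Q, dominates Q (val T).
  by apply: trace_class_dominated; exact: set_valP.
have V0 J : V J !=set0.
  have [| |c cS|B SB hB] := @common_value _ _ (size J) Sp
    (fun i B => trace (val (tnth (in_tuple J) i) \o B)) A.
  - by split; [exact: operator_span0|move=> *; exact: operator_span_lin].
  - by move=> i a B C; have [Q hQ] := dom (tnth (in_tuple J) i);
      exact: trace_linr hQ.
  - have [[Q hQ] hT] := trace_suml c (fun i => dom (tnth (in_tuple J) i)).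
    rewrite -hT (@trace_eq0 Q _ ic hQ) ?trace0// => E bE.
    by rewrite hT; apply: cS; apply: operator_span_sub; exists E.
  - exists B; split=> // T TJ.
    by have := hB (Ordinal (etrans (index_mem T J) TJ)); rewrite /tnth nth_index.
(* The sets [V J] generate a filter that contains the span and converges to
   [A]. *)
pose F := filter_from setT V.
have FF : Filter F.
  apply: filter_fromT_filter; first by exists [::].
  move=> J J'; exists (J ++ J') => B [SB hB].
  by split; split=> // T TJ; apply: hB; rewrite mem_cat TJ ?orbT.
have FA : F --> (A : ultraweak H).
  apply: ultraweak_cvg => T Tt; have Tm : T \in trace_class H by rewrite inE.
  exists [:: Sub T Tm : trace_class H] => // B [_ /(_ (Sub T Tm))].
  by rewrite inE eqxx; apply.
by move=> U /FA[J _ JU]; have [B VB] := V0 J; exists B; split; [case: VB|exact: JU].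
Qed.

Lemma dense_complete : measurement_space nu = [set: bounded_operator H] ->
  informationally_complete nu.
Proof.
move=> dense rho1 rho2 [_ tc1 _] [_ tc2 _] rho12.
have [Q1 h1] := trace_class_dominated tc1.
have [Q2 h2] := trace_class_dominated tc2.
have agree A : trace (rho1 \o A) = trace (rho2 \o A).
  have span B : operator_span (nu @` @borel X) B ->
      trace (rho1 \o B) = trace (rho2 \o B).
    move=> [n [c [C [CE ->]]]]; rewrite (trace_sumr _ _ h1) (trace_sumr _ _ h2).
    by apply: eq_bigr => i _; have [E bE <-] := CE i; rewrite rho12.
  pose g (B : ultraweak H) : R[i]^o := trace (rho1 \o B) - trace (rho2 \o B).
  have gc : continuous g.
    move=> B; exact: (cvgB (ultraweak_trace_continuous tc1 (x := B))
      (ultraweak_trace_continuous tc2 (x := B))).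
  have gK : closed (g @^-1` [set 0]).
    apply: preimage_closed => [B _|]; first exact: gc.
    apply: accessible_closed_set1; apply: hausdorff_accessible.
    exact: (@norm_hausdorff _ R[i]^o).
  have : measurement_space nu A by rewrite dense.
  move=> /(closure_subset (B := g @^-1` [set 0])).
  rewrite -(closure_id _).1// => h; apply/eqP; rewrite -subr_eq0; apply/eqP.
  by apply: h => B /span h; rewrite /preimage/= /g h subrr.
apply: operatorP => x; apply/eqP; rewrite -subr_eq0; apply/eqP.
apply: hilbert_basis_total => e Ee.
by rewrite innerBl -!trace_rank1// agree subrr.
Qed.

End quantum_probability.

Theorem proposition4p3 (R : realType) (H : hilbertType R)
    (X : topologicalType) (hausX : hausdorff_space X)
    (lcX : locally_compact [set: X])
    (nu : set X -> bounded_operator H)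
    (hnu : quantum_probability_measure nu) :
  informationally_complete nu <->
  measurement_space nu = [set: bounded_operator H].
Proof. by split; [exact: complete_dense|exact: dense_complete]. Qed.
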